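(* Suppose that $f$ has the MLR property, i.e. $f(x_1-\eta_1)f(x_2-\eta_2)\ge f(x_1-\eta_2)f(x_2-\eta_1)$ whenever $x_1<x_2$ and $\eta_1<\eta_2$, that $\lim_{t\to\infty}f(t)=0$, and that $W$ satisfies (C1)--(C3) (listed in the context). For $\theta\ge0$ let $g_\theta(z)=F(z+\theta)f(z)+F(z)f(z+\theta)$, $z\in\mathbb{R}$, and suppose that $\int_{-\infty}^{\infty}W'(x-b)g_\theta(x)\,dx=0$ has a unique solution $b=b_\theta$ for every $\theta\ge 0$ and that $\theta\mapsto b_\theta$ is continuous on $[0,\infty)$. Let $b_\infty=\inf_{\theta\ge0}b_\theta$. Then the estimators that are admissible within the class $\mathcal D=\{X_{(2)}-b: b\in\mathbb{R}\}$, for estimating $\theta_{(2)}$ under the loss $W(a-\theta_{(2)})$, are exactly those in $\{X_{(2)}-b:\ b_\infty\le b\le b_0\}$.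
   Context: Setting: $f$ is a Lebesgue probability density on $\mathbb{R}$ with distribution function $F(x)=\int_{-\infty}^x f(t)\,dt$; $X_1,X_2$ are independent and $X_i$ has density $x\mapsto f(x-\theta_i)$, where $\boldsymbol\theta=(\theta_1,\theta_2)\in\mathbb{R}^2$ is unknown. Write $\theta_{(2)}=\max\{\theta_1,\theta_2\}$ and $X_{(2)}=\max\{X_1,X_2\}$. The loss for estimating $\theta_{(2)}$ is $L(\boldsymbol\theta,a)=W(a-\theta_{(2)})$, $W:\mathbb{R}\to[0,\infty)$; the risk of $\delta$ is $R(\boldsymbol\theta,\delta)=E_{\boldsymbol\theta}[W(\delta(X_1,X_2)-\theta_{(2)})]$. Conditions on $W$: (C1) $W(0)=0$, $W$ is strictly decreasing on $(-\infty,0)$ and strictly increasing on $(0,\infty)$; (C2) $W'$ is increasing almost everywhere; (C3) the integrals involving $W$ are finite and differentiation under the integral sign is permissible. An estimator $\delta\in\mathcal D$ is admissible within $\mathcal D$ if there is no $\delta'\in\mathcal D$ with $R(\boldsymbol\theta,\delta')\le R(\boldsymbol\theta,\delta)$ for all $\boldsymbol\theta\in\mathbb{R}^2$ and strict inequality for some $\boldsymbol\theta$. Here $b_0$ denotes $b_\theta$ at $\theta=0$. *)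

(* Defs.v *)
From mathcomp Require Import all_boot all_order all_algebra.
From mathcomp Require Import all_classical all_reals all_analysis.
Set Implicit Arguments.
Unset Strict Implicit.
Unset Printing Implicit Defensive.
Import Order.TTheory GRing.Theory Num.Theory.
Import numFieldNormedType.Exports.
Local Open Scope classical_set_scope.
Local Open Scope ring_scope.

Definition is_density (R : realType) (f : R -> R) : Prop :=
  [/\ measurable_fun [set: R] f,
      forall x, 0 <= f x
    & (\int[lebesgue_measure]_x (f x)%:E = 1)%E].

Definition distribution_fun (R : realType) (f : R -> R) (x : R) : R :=
  \int[lebesgue_measure]_(t in `]-oo, x]) f t.

Definition has_density d (T : measurableType d) (R : realType)
    (P : probability T R) (X : {RV P >-> R}) (p : R -> R) : Prop :=
  forall A : set R, measurable A ->
    distribution P X A = (\int[lebesgue_measure]_(x in A) (p x)%:E)%E.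

Definition independent_rv d (T : measurableType d) (R : realType)
    (P : probability T R) (X Y : {RV P >-> R}) : Prop :=
  forall A B : set R, measurable A -> measurable B ->
    P (X @^-1` A `&` Y @^-1` B) = (P (X @^-1` A) * P (Y @^-1` B))%E.

Definition location_model d (T : measurableType d) (R : realType) (f : R -> R)
    (P : R * R -> probability T R) (X1 X2 : {mfun T >-> R}) : Prop :=
  forall th : R * R,
    [/\ @independent_rv d T R (P th) X1 X2,
        @has_density d T R (P th) X1 (fun x => f (x - th.1))
      & @has_density d T R (P th) X2 (fun x => f (x - th.2))].

Definition MLR (R : realType) (f : R -> R) : Prop :=
  forall x1 x2 eta1 eta2 : R, x1 < x2 -> eta1 < eta2 ->
    f (x1 - eta2) * f (x2 - eta1) <= f (x1 - eta1) * f (x2 - eta2).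

(* The density of X_(2) - theta_(2) when |theta_1 - theta_2| = t. *)
Definition gdens (R : realType) (f : R -> R) (t z : R) : R :=
  distribution_fun f (z + t) * f z + distribution_fun f z * f (z + t).

Definition condC1 (R : realType) (W : R -> R) : Prop :=
  [/\ W 0 = 0,
      forall s t : R, s < t -> t < 0 -> W t < W s
    & forall s t : R, 0 < s -> s < t -> W s < W t].

(* "Increasing" is weak here (it is "strictly increasing" in condC1), so that
   for instance W t = `|t| is allowed. *)
Definition condC2 (R : realType) (W : R -> R) : Prop :=
  exists N : set R,
    [/\ (@lebesgue_measure R).-negligible N,
        forall x, ~ N x -> derivable W x 1
      & forall x y, ~ N x -> ~ N y -> x <= y -> derive1 W x <= derive1 W y].

(* The integrals involving W are those of x |-> W (x - c) and x |-> W' (x - c)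
   against the densities gdens f t; the differentiation is in the shift c. *)
Definition condC3 (R : realType) (f W : R -> R) : Prop :=
  forall t c : R, 0 <= t ->
    [/\ lebesgue_measure.-integrable [set: R]
          (fun x => (W (x - c) * gdens f t x)%:E),
        lebesgue_measure.-integrable [set: R]
          (fun x => (derive1 W (x - c) * gdens f t x)%:E)
      & is_derive c 1
          (fun c' : R => \int[lebesgue_measure]_x (W (x - c') * gdens f t x))
          (\int[lebesgue_measure]_x (- derive1 W (x - c) * gdens f t x))].

Definition risk d (T : measurableType d) (R : realType) (W : R -> R)
    (P : R * R -> probability T R) (X1 X2 : T -> R)
    (th : R * R) (delta : R * R -> R) : \bar R :=
  'E_(P th)[(fun w => W (delta (X1 w, X2 w) - Num.max th.1 th.2))%R].

Definition admissible_within (R : realType) (Theta Delta : Type)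
    (r : Theta -> Delta -> \bar R) (D : set Delta) (delta : Delta) : Prop :=
  D delta /\
  ~ exists delta' : Delta,
      [/\ D delta',
          forall th, (r th delta' <= r th delta)%E
        & exists th, (r th delta' < r th delta)%E].

Definition max_shift (R : realType) (c : R) : R * R -> R :=
  fun x => Num.max x.1 x.2 - c.

(* Main.v *)
(* For [t = |theta_1 - theta_2|] the risk of [X_(2) - c] is
   [h_t(c) = int W(x - c) g_t(x) dx], whose derivative in [c] is [- s_t(c)] with
   [s_t(c) = int W'(x - c) g_t(x) dx]. As [W'] is nondecreasing so is [- s_t],
   hence [h_t] strictly decreases before the unique zero [b_t] of [s_t] and
   strictly increases after it. By MLR the ratio [g_0 / g_t] is nondecreasing,
   and a single crossing argument yields [b_t <= b_0]. So [c > b_0] is dominated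
   by [b_0] and [c < b_oo] by [b_oo], while each [c] in the range of [b], which
   is an interval by continuity, is the unique optimum for some [t].

   There remains [c = b_oo] when the infimum is not attained, so that it is
   approached only as [t -> oo]. If [c' > c], choose [r] with [b_r < c'] and
   [s1 < b_r < s2] inside [(c, c')]. By MLR, [g_r <= 2 g_t] for [t >= r], so
   that [s_t(s1) - s_t(s2)] is bounded below by some [dl > 0]; once [b_t < s1]
   this makes [h_t] increase by at least [dl (c' - s2)] on [s2, c'], whereas it
   decreases by at most [(b_t - c) sup_t s_t(c) -> 0] on [c, b_t]. Hence [c']
   does not dominate [c]. *)
Require Import Defs.
From mathcomp Require Import all_boot all_order all_algebra.
From mathcomp Require Import all_classical all_reals all_analysis.
From mathcomp Require Import measurable_realfun ring lra.
Import Order.TTheory GRing.Theory Num.Theory.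
Import numFieldNormedType.Exports.
Import HBNNSimple.
Local Open Scope classical_set_scope.
Local Open Scope ring_scope.
Set Implicit Arguments.
Unset Strict Implicit.

(** * Lebesgue measure: translations and densities *)

(** The image of Lebesgue measure under a translation agrees with it on half-open intervals, which
    determine it. *)
Lemma lebesgue_measure_shift (R : realType) (c : R) (A : set R) :
  measurable A ->
  lebesgue_measure ((fun x : R => x + c) @^-1` A) = lebesgue_measure A.
Proof.
move=> mA.
have mshift : measurable_fun [set: measurableTypeR R]
    (fun x : R => (x + c : measurableTypeR R)).
  by apply: measurable_funD.
pose sh : measurableTypeR R -> measurableTypeR R := fun x => x + c.
rewrite -[LHS]/(pushforward (@lebesgue_measure R) sh A).
apply/esym.
apply: (@lebesgue_measure_unique R (pushforward lebesgue_measure sh)) => //.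
move=> _ [[a b]] _ <-.
have shE : sh @^-1` `]a, b] = `]a - c, b - c]%classic.
  by apply/seteqP; split=> x /=; rewrite !in_itv/= ltrBlDr lerBrDr.
rewrite /= /pushforward shE !lebesgue_measure_itv/= !lte_fin ltrD2r.
by case: ifPn => // _; rewrite -!EFinD; congr EFin; ring.
Qed.

Lemma ge0_integral_shift (R : realType) (c : R) (phi : R -> \bar R) :
  measurable_fun [set: R] phi -> (forall x, 0 <= phi x)%E ->
  (\int[lebesgue_measure]_x phi (x + c)%R = \int[lebesgue_measure]_x phi x)%E.
Proof.
move=> mphi phi0.
have mshift : measurable_fun [set: measurableTypeR R]
    (fun x : R => (x + c : measurableTypeR R)).
  by apply: measurable_funD.
transitivity (\int[pushforward (@lebesgue_measure R)
    (fun x : measurableTypeR R => (x + c)%R : measurableTypeR R)]_x phi x)%E.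
  by rewrite ge0_integral_pushforward.
apply: eq_measure_integral => A mA _.
exact: lebesgue_measure_shift.
Qed.

Lemma negligible_shift (R : realType) (c : R) (N : set R) :
  lebesgue_measure.-negligible N ->
  lebesgue_measure.-negligible [set x : R | N (x + c)].
Proof.
move=> [M [mM M0 NM]]; exists ((fun x : R => x + c) @^-1` M); split.
- have mshift : measurable_fun [set: measurableTypeR R]
      (fun x : R => (x + c : measurableTypeR R)) by apply: measurable_funD.
  by rewrite -[X in measurable X]setTI; exact: mshift.
- by rewrite lebesgue_measure_shift.
- by move=> x /NM.
Qed.

(** By linearity the identity passes from sets to simple functions, and by monotone convergence
    along [nnsfun_approx] to all nonnegative measurable functions. *)
Lemma ge0_integral_density (d : measure_display) (T : measurableType d)
    (R : realType) (mu nu : {measure set T -> \bar R}) (p : T -> R)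
    (phi : T -> \bar R) :
  measurable_fun [set: T] p -> (forall x, 0 <= p x) ->
  (forall A, measurable A -> nu A = \int[mu]_(x in A) (p x)%:E)%E ->
  measurable_fun [set: T] phi -> (forall x, 0 <= phi x)%E ->
  (\int[nu]_x phi x = \int[mu]_x (phi x * (p x)%:E))%E.
Proof.
move=> mp p0 nuE mphi phi0.
pose f_ := nnsfun_approx measurableT mphi.
have mpE : measurable_fun [set: T] (EFin \o p) by apply/measurable_EFinP.
have phi_lim x : limn (fun n => (f_ n x)%:E) = phi x.
  by apply/cvg_lim => //; apply: cvg_nnsfun_approx.
transitivity (limn (fun n => \int[nu]_x (f_ n x)%:E)%E).
  rewrite -monotone_convergence//.
  - by apply: eq_integral => x _; rewrite phi_lim.
  - by move=> n; exact/measurable_EFinP/measurable_funP.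
  - by move=> n x _; rewrite lee_fin.
  - by move=> x _ m n mn; rewrite lee_fin; exact/lefP/nd_nnsfun_approx.
rewrite [X in limn X](_ : _ =
    (fun n => \int[mu]_x ((f_ n x)%:E * (p x)%:E))%E).
  rewrite -monotone_convergence//.
  - apply: eq_integral => x _; apply/cvg_lim => //.
    apply: cvgeZr => //.
    by rewrite -phi_lim; apply: cvgP; apply: cvg_nnsfun_approx.
  - move=> n; apply: emeasurable_funM => //.
    exact/measurable_EFinP/measurable_funP.
  - by move=> n x _; rewrite mule_ge0 ?lee_fin.
  - move=> x _ m n mn; rewrite lee_wpmul2r ?lee_fin//.
    exact/lefP/nd_nnsfun_approx.
apply/funext => n.
rewrite integralT_nnsfun sintegralE.
transitivity (\sum_(r \in range (f_ n))
    \int[mu]_x ((r * \1_(f_ n @^-1` [set r]) x)%:E * (p x)%:E))%E; last first.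
  rewrite -ge0_integral_fsum//.
  - apply: eq_integral => x _; rewrite [f_ n x]fimfunE -fsumEFin//.
    by rewrite ge0_mule_fsuml// => r; rewrite nnfun_muleindic_ge0.
  - move=> r; apply: emeasurable_funM => //.
    by apply/measurable_EFinP/measurable_funM.
  - by move=> r x _; rewrite mule_ge0 ?lee_fin// -lee_fin nnfun_muleindic_ge0.
apply: eq_fsbigr => r /[!inE] -[y _ <-].
rewrite nuE// integral_mkcond.
rewrite -ge0_integralZl//; last 3 first.
- by apply/(measurable_restrictT _ _).1 => //; exact: measurable_funTS.
- by move=> x _; rewrite patchE; case: ifP => // _; rewrite lee_fin.
- by rewrite lee_fin.
apply: eq_integral => x _; rewrite patchE indicE EFinM -muleA; congr (_ * _)%E.
by case: ifPn; rewrite ?mul1e ?mul0e.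
Qed.

(** * The law of the maximum of two independent variables *)

(** Independence makes the joint law agree with the product measure on rectangles, hence
    everywhere. *)
Lemma ge0_integral_indep (d : measure_display) (T : measurableType d)
    (R : realType) (P : probability T R) (X1 X2 : {RV P >-> R})
    (h : R * R -> \bar R) :
  independent_rv X1 X2 ->
  measurable_fun [set: R * R] h -> (forall z, 0 <= h z)%E ->
  (\int[P]_w h (X1 w, X2 w) =
   \int[distribution P X1 \x distribution P X2]_z h z)%E.
Proof.
move=> indep mh h0.
have mX : measurable_fun [set: T] (fun w => (X1 w, X2 w)).
  exact: measurable_fun_pair.
transitivity (\int[pushforward P (fun w => (X1 w, X2 w))]_z h z)%E.
  by rewrite ge0_integral_pushforward.
apply: eq_measure_integral => A mA _; apply/esym.
by apply: product_measure_unique.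
Qed.

Lemma ge0_integral_distribution (d : measure_display) (T : measurableType d)
    (R : realType) (P : probability T R) (X : {RV P >-> R})
    (p : R -> R) (phi : R -> \bar R) :
  measurable_fun [set: R] p -> (forall x, 0 <= p x) -> has_density X p ->
  measurable_fun [set: R] phi -> (forall x, 0 <= phi x)%E ->
  (\int[distribution P X]_x phi x =
   \int[lebesgue_measure]_x (phi x * (p x)%:E))%E.
Proof.
move=> mp p0 Xp mphi phi0.
have mX : measurable_fun [set: T] (X : T -> measurableTypeR R).
  by move=> mT Y mY; exact: (@measurable_funPT _ _ _ _ X).
(* The law of [X] is pulled back to [P] and pushed forward again, now to [measurableTypeR R], the
   type carrying Lebesgue measure. *)
rewrite ge0_integral_pushforward// preimage_setT.
transitivity (\int[pushforward P (X : T -> measurableTypeR R)]_x phi x)%E.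
  by rewrite ge0_integral_pushforward.
exact: ge0_integral_density.
Qed.

(** The plane is cut along the diagonal, ties going to [h1]. On each piece the maximum is one
    coordinate, and integrating out the other by Tonelli leaves its [cdf]. *)
Lemma ge0_integral_max_indep (d : measure_display) (T : measurableType d)
    (R : realType) (P : probability T R) (X1 X2 : {RV P >-> R})
    (p1 p2 : R -> R) (phi : R -> \bar R) :
  independent_rv X1 X2 ->
  measurable_fun [set: R] p1 -> (forall x, 0 <= p1 x) -> has_density X1 p1 ->
  measurable_fun [set: R] p2 -> (forall x, 0 <= p2 x) -> has_density X2 p2 ->
  measurable_fun [set: R] phi -> (forall x, 0 <= phi x)%E ->
  (\int[P]_w phi (Num.max (X1 w) (X2 w)) =
   \int[lebesgue_measure]_x
     (phi x * (cdf X1 x * (p2 x)%:E + cdf X2 x * (p1 x)%:E)))%E.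
Proof.
move=> indep mp1 p10 X1p mp2 p20 X2p mphi phi0.
have mle : measurable [set z : R * R | z.1 <= z.2].
  by rewrite -[X in measurable X]setTI; apply: measurable_fun_le.
pose h1 (z : R * R) : \bar R :=
  (phi z.2 * (\1_[set z : R * R | (z.1 <= z.2)%R] z)%:E)%E.
pose h2 (z : R * R) : \bar R :=
  (phi z.1 * (\1_(~` [set z : R * R | (z.1 <= z.2)%R]) z)%:E)%E.
have mh1 : measurable_fun [set: R * R] h1.
  apply: emeasurable_funM; first exact: measurableT_comp.
  by apply/measurable_EFinP; exact: measurable_indic.
have mh2 : measurable_fun [set: R * R] h2.
  apply: emeasurable_funM; first exact: measurableT_comp.
  by apply/measurable_EFinP; apply: measurable_indic; exact: measurableC.
have h10 z : (0 <= h1 z)%E by rewrite mule_ge0 ?lee_fin.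
have h20 z : (0 <= h2 z)%E by rewrite mule_ge0 ?lee_fin.
have hE z : phi (Num.max z.1 z.2) = (h1 z + h2 z)%E.
  rewrite /h1 /h2 !indicE in_setC.
  have [zle|zlt] := leP z.1 z.2.
    by rewrite mem_set//= mule1 mule0 adde0.
  by rewrite memNset/= ?mule1 ?mule0 ?add0e//; apply/negP; rewrite -ltNge.
rewrite (ge0_integral_indep (h := fun z => phi (Num.max z.1 z.2)))//;
  last first.
  rewrite (_ : (fun _ => _) = h1 \+ h2)%E ?(funext hE)//.
  exact: emeasurable_funD.
under eq_integral do rewrite hE.
rewrite ge0_integralD//.
rewrite fubini_tonelli2// fubini_tonelli1// /fubini_F /fubini_G.
have -> : (\int[distribution P X2]_y \int[distribution P X1]_x h1 (x, y) =
    \int[distribution P X2]_y (phi y * cdf X1 y))%E.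
  apply: eq_integral => y _; rewrite /h1/= ge0_integralZl//; last first.
    apply/measurable_EFinP; apply: measurableT_comp => //.
  congr (_ * _)%E.
  rewrite /cdf -[X in distribution P X1 X]setIT -integral_indic//.
have -> : (\int[distribution P X1]_x \int[distribution P X2]_y h2 (x, y) =
    \int[distribution P X1]_x (phi x * cdf X2 x))%E.
  apply: eq_integral => x _; rewrite /h2/= ge0_integralZl//; last first.
    apply/measurable_EFinP; apply: measurableT_comp => //.
      by apply: measurable_indic; exact: measurableC.
  congr (_ * _)%E.
  (* The section of [h2] is an open half-line; its endpoint has no mass since [X2] has a density. *)
  have -> : cdf X2 x = distribution P X2 `]-oo, x[%classic.
    rewrite /cdf !X2p//.
    rewrite integral_itv_bndo_bndc//.
    by apply/measurable_EFinP; exact: measurable_funTS.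
  rewrite -[X in distribution P X2 X]setIT -integral_indic//.
  apply: eq_integral => y _; rewrite !indicE; congr ((nat_of_bool _)%:R%:E).
  by apply/idP/idP => /set_mem/= xy; apply/mem_set;
    move: xy; rewrite /= in_itv/= ltNge => /negP.
have mc1 := cdf_measurable X1.
have mc2 := cdf_measurable X2.
have mpc1 : measurable_fun [set: R] (fun x => phi x * cdf X1 x)%E.
  exact: emeasurable_funM.
have mpc2 : measurable_fun [set: R] (fun x => phi x * cdf X2 x)%E.
  exact: emeasurable_funM.
rewrite (ge0_integral_distribution mp2)//; last first.
  by move=> y; rewrite mule_ge0// cdf_ge0.
rewrite (ge0_integral_distribution mp1)//; last first.
  by move=> y; rewrite mule_ge0// cdf_ge0.
rewrite -ge0_integralD//; last 4 first.
- by move=> y _; rewrite !mule_ge0 ?lee_fin ?cdf_ge0.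
- by apply: emeasurable_funM; [exact: emeasurable_funM|exact/measurable_EFinP].
- by move=> y _; rewrite !mule_ge0 ?lee_fin ?cdf_ge0.
- by apply: emeasurable_funM; [exact: emeasurable_funM|exact/measurable_EFinP].
apply: eq_integral => x _.
by rewrite -!muleA ge0_muleDr// mule_ge0 ?lee_fin ?cdf_ge0.
Qed.

(** * Distribution function, risk and monotone likelihood ratio *)

Lemma density_integrable (R : realType) (f : R -> R) : is_density f ->
  lebesgue_measure.-integrable [set: R] (EFin \o f).
Proof.
move=> [mf f0 f1]; apply/integrableP; split; first exact/measurable_EFinP.
under eq_integral do rewrite /= ger0_norm//.
by rewrite f1 ltry.
Qed.

Lemma density_shift (R : realType) (f : R -> R) (t : R) :
  is_density f -> is_density (fun x => f (x + t)).
Proof.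
move=> [mf f0 f1]; split => //.
- apply: (measurableT_comp mf); exact: measurable_funD.
- rewrite (ge0_integral_shift t (phi := fun x => (f x)%:E))//.
  exact/measurable_EFinP.
Qed.

Lemma EFin_distribution_fun (R : realType) (f : R -> R) (x : R) :
  is_density f ->
  (distribution_fun f x)%:E =
  (\int[lebesgue_measure]_(t in `]-oo, x]) (f t)%:E)%E.
Proof.
move=> hf; rewrite /distribution_fun /Rintegral fineK//.
apply: integrable_fin_num => //.
by apply: integrableS (density_integrable hf).
Qed.

Lemma distribution_fun_ge0 (R : realType) (f : R -> R) (x : R) :
  is_density f -> 0 <= distribution_fun f x.
Proof. by move=> [_ f0 _]; apply: Rintegral_ge0. Qed.

Lemma distribution_funB (R : realType) (f : R -> R) (x y : R) :
  is_density f -> x <= y ->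
  distribution_fun f y - distribution_fun f x =
  \int[lebesgue_measure]_(t in `]x, y]) f t.
Proof.
move=> hf xy; rewrite /distribution_fun.
rewrite -(Rintegral_itvB (a := -oo%O) (b := BRight y))//.
by apply: integrableS (density_integrable hf).
Qed.

Lemma distribution_fun_nondecreasing (R : realType) (f : R -> R) (x y : R) :
  is_density f -> x <= y -> distribution_fun f x <= distribution_fun f y.
Proof.
move=> hf xy; rewrite -subr_ge0 distribution_funB//.
by case: hf => _ f0 _; apply: Rintegral_ge0.
Qed.

Lemma distribution_fun_le1 (R : realType) (f : R -> R) (x : R) :
  is_density f -> distribution_fun f x <= 1.
Proof.
move=> hf; rewrite -lee_fin EFin_distribution_fun//; case: hf => mf f0 <-.
apply: ge0_subset_integral => //; first exact/measurable_EFinP.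
by move=> t _; rewrite lee_fin.
Qed.

Lemma integral_itv_shift (R : realType) (f : R -> R) (t x : R) :
  is_density f ->
  (\int[lebesgue_measure]_(u in `]-oo, x]) (f (u + t))%:E =
   \int[lebesgue_measure]_(u in `]-oo, (x + t)%R]) (f u)%:E)%E.
Proof.
move=> [mf f0 _]; rewrite integral_mkcond [RHS]integral_mkcond.
rewrite -[RHS](ge0_integral_shift t).
- apply: eq_integral => u _; rewrite !patchE.
  suff -> : (u \in `]-oo, x]%classic) =
    ((u + t)%R \in `]-oo, (x + t)%R]%classic) by [].
  by rewrite !mem_setE !in_itv/= lerD2r.
- apply/(measurable_restrictT _ _).1 => //.
  by apply/measurable_EFinP; exact: measurable_funTS.
- by move=> u; rewrite patchE; case: ifP => // _; rewrite lee_fin.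
Qed.

Lemma distribution_fun_shift (R : realType) (f : R -> R) (t x : R) :
  is_density f ->
  distribution_fun (fun u => f (u + t)) x = distribution_fun f (x + t).
Proof.
by move=> hf; rewrite /distribution_fun /Rintegral integral_itv_shift.
Qed.

Lemma measurable_distribution_fun (R : realType) (f : R -> R) :
  is_density f -> measurable_fun [set: R] (distribution_fun f).
Proof.
move=> hf; apply: nondecreasing_measurable => // x y.
exact: distribution_fun_nondecreasing.
Qed.

Lemma gdens_ge0 (R : realType) (f : R -> R) (t x : R) :
  is_density f -> 0 <= gdens f t x.
Proof.
move=> hf; have [_ f0 _] := hf.
by rewrite addr_ge0// mulr_ge0// distribution_fun_ge0.
Qed.

Lemma measurable_gdens (R : realType) (f : R -> R) (t : R) :
  is_density f -> measurable_fun [set: R] (gdens f t).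
Proof.
move=> hf; have [mf _ _] := hf; have mF := measurable_distribution_fun hf.
have mt : measurable_fun [set: R] (fun x : R => x + t).
  exact: measurable_funD.
apply: measurable_funD; apply: measurable_funM => //.
- exact: (measurableT_comp mF).
- exact: (measurableT_comp mf).
Qed.

(** This is [MLR] at the points [u + t < v + t] with parameters [0 < t]; in the degenerate cases
    both sides are equal. *)
Lemma MLR_shift (R : realType) (f : R -> R) (u v t : R) :
  MLR f -> u <= v -> 0 <= t -> f u * f (v + t) <= f (u + t) * f v.
Proof.
move=> hM; rewrite le_eqVlt => /predU1P[->|uv]; first by rewrite mulrC.
rewrite le_eqVlt => /predU1P[<-|t0]; first by rewrite !addr0.
have := hM (u + t) (v + t) 0 t; rewrite !subr0 !addrK; apply => //.
by rewrite ltrD2r.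
Qed.

(** [MLR_shift] is integrated in its first point over []-oo, x]]. *)
Lemma MLR_distribution_density (R : realType) (f : R -> R) (x y t : R) :
  is_density f -> MLR f -> x <= y -> 0 <= t ->
  distribution_fun f x * f (y + t) <= distribution_fun f (x + t) * f y.
Proof.
move=> hf hM xy t0.
have hi (g : R -> R) : is_density g ->
    lebesgue_measure.-integrable `]-oo, x] (EFin \o g).
  by move=> hg; apply: integrableS (density_integrable hg).
have hft := density_shift t hf.
rewrite -(distribution_fun_shift t x hf) /distribution_fun.
rewrite -!RintegralZr//; [|exact: hi|exact: hi].
apply: le_Rintegral => //.
- rewrite (_ : _ \o _ = fun u => (f u)%:E * (f (y + t))%:E)%E//.
  by apply: integrableZr => //; exact: hi.
- rewrite (_ : _ \o _ = fun u => (f (u + t))%:E * (f y)%:E)%E//.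
  by apply: integrableZr => //; exact: hi.
- move=> u /=; rewrite in_itv/= => ux.
  by apply: MLR_shift => //; exact: le_trans xy.
Qed.

Lemma MLR_distribution (R : realType) (f : R -> R) (x y t : R) :
  is_density f -> MLR f -> x <= y -> 0 <= t ->
  distribution_fun f x * distribution_fun f (y + t) <=
  distribution_fun f (x + t) * distribution_fun f y.
Proof.
move=> hf hM xy t0.
have hi (g : R -> R) : is_density g ->
    lebesgue_measure.-integrable `]x, y] (EFin \o g).
  by move=> hg; apply: integrableS (density_integrable hg).
have hft := density_shift t hf.
(* Subtracting [F(x) F(x + t)] from both sides leaves increments over []x, y]], so that the previous
   lemma can be integrated in [y]. *)
suff : distribution_fun f x *
      (distribution_fun f (y + t) - distribution_fun f (x + t)) <=
    distribution_fun f (x + t) * (distribution_fun f y - distribution_fun f x).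
  by lra.
rewrite -!(distribution_fun_shift t _ hf) !distribution_funB//.
rewrite (distribution_fun_shift t _ hf).
rewrite -!RintegralZl//; [|exact: hi|exact: hi].
apply: le_Rintegral => //.
- rewrite (_ : _ \o _ =
      fun u => (distribution_fun f x)%:E * (f (u + t))%:E)%E//.
  by apply: integrableZl => //; exact: hi.
- rewrite (_ : _ \o _ =
      fun u => (distribution_fun f (x + t))%:E * (f u)%:E)%E//.
  by apply: integrableZl => //; exact: hi.
- move=> u /=; rewrite in_itv/= => /andP[xu uy].
  by apply: MLR_distribution_density => //; exact: ltW.
Qed.

(** As [W 0 = 0], [W] is the sum of its parts right and left of 0, one nondecreasing and the other
    nonincreasing. *)
Lemma condC1_measurable (R : realType) (W : R -> R) :
  condC1 W -> (forall t, 0 <= W t) -> measurable_fun [set: R] W.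
Proof.
move=> [W00 Wdecr Wincr] W0.
have -> : W = (fun x => W (Num.max x 0)) \- (fun x => - W (Num.min x 0)).
  apply/funext => x /=; rewrite opprK.
  by have [x0|x0] := leP x 0; rewrite W00 ?addr0 ?add0r.
apply: measurable_funB; apply: nondecreasing_measurable => // x y xy.
- have [x0|x0] := leP x 0; first by rewrite W00.
  rewrite max_l; last by rewrite (le_trans (ltW x0)).
  by move: xy; rewrite le_eqVlt => /predU1P[->//|xy]; apply/ltW/Wincr.
- rewrite lerN2; have [y0|y0] := leP 0 y; first by rewrite W00.
  rewrite min_l; last by rewrite (le_trans xy (ltW y0)).
  by move: xy; rewrite le_eqVlt => /predU1P[->//|xy]; apply/ltW/Wdecr.
Qed.

(** Translation by [theta_(2)] puts one argument at [x] and the other at [x + |theta_1 - theta_2|];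
    the density of the maximum is symmetric in the two variables. *)
Lemma risk_max_shift (d : measure_display) (T : measurableType d)
    (R : realType) (f W : R -> R) (P : R * R -> probability T R)
    (X1 X2 : {mfun T >-> R}) (th : R * R) (c : R) :
  is_density f -> location_model f P X1 X2 ->
  measurable_fun [set: R] W -> (forall t, 0 <= W t) ->
  risk W P X1 X2 th (max_shift c) =
  (\int[lebesgue_measure]_x (W (x - c) * gdens f `|th.1 - th.2| x)%:E)%E.
Proof.
move=> hf hX mW W0; have [indep X1p X2p] := hX th.
have [mf f0 _] := hf.
have hd (s : R) := density_shift (- s) hf.
have [mf1 f10 _] := hd th.1; have [mf2 f20 _] := hd th.2.
set m := Num.max th.1 th.2.
pose phi x := (W (x - c - m))%:E.
have mphi : measurable_fun [set: R] phi.
  apply/measurable_EFinP; apply: (measurableT_comp mW).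
  by do 2 apply: measurable_funB => //.
have phi0 x : (0 <= phi x)%E by rewrite lee_fin.
have cdfE (X : {RV (P th) >-> R}) s x : has_density X (fun x => f (x - s)) ->
    cdf X x = (distribution_fun f (x - s))%:E.
  move=> Xp; rewrite /cdf Xp// -(distribution_fun_shift (- s))//.
  by rewrite EFin_distribution_fun.
rewrite /risk unlock.
rewrite (ge0_integral_max_indep indep mf1 f10 X1p mf2 f20 X2p mphi phi0).
pose g x := (W (x - c - m) * (distribution_fun f (x - th.1) * f (x - th.2) +
  distribution_fun f (x - th.2) * f (x - th.1)))%:E.
transitivity (\int[lebesgue_measure]_x g x)%E.
  by apply: eq_integral => x _; rewrite (cdfE X1 th.1)// (cdfE X2 th.2).
rewrite -(ge0_integral_shift m); last 2 first.
- apply/measurable_EFinP; apply: measurable_funM; first exact/measurable_EFinP.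
  have mF s : measurable_fun [set: R] (fun x => distribution_fun f (x - s)).
    apply: (measurableT_comp (measurable_distribution_fun hf)).
    exact: measurable_funB.
  by apply: measurable_funD; exact: measurable_funM.
- by move=> x; rewrite lee_fin mulr_ge0// addr_ge0// mulr_ge0//
    distribution_fun_ge0.
apply: eq_integral => x _; rewrite /g; congr (_ * _)%:E.
  by congr W; ring.
rewrite /gdens /m; have [th12|th12] := leP th.1 th.2.
  by rewrite ler0_norm ?subr_le0// opprB addrK addrA.
by rewrite gtr0_norm ?subr_gt0// addrK addrA [LHS]addrC.
Qed.

(** By MLR the second summand of [gdens f s x] is at most the first, [F(x + s) f(x)], which is at
    most [F(x + t) f(x)]. *)
Lemma gdens_le (R : realType) (f : R -> R) (s t x : R) :
  is_density f -> MLR f -> 0 <= s -> s <= t ->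
  gdens f s x <= 2 * gdens f t x.
Proof.
move=> hf hM s0 st; have [_ f0 _] := hf.
have h1 := MLR_distribution_density hf hM (lexx x) s0.
have h2 : distribution_fun f (x + s) * f x <= distribution_fun f (x + t) * f x.
  by rewrite ler_wpM2r// distribution_fun_nondecreasing// lerD2l.
have h3 : 0 <= distribution_fun f x * f (x + t).
  by rewrite mulr_ge0// distribution_fun_ge0.
by rewrite /gdens; lra.
Qed.

Lemma gdens_le_density (R : realType) (f : R -> R) (t x : R) :
  is_density f -> MLR f -> 0 <= t -> gdens f t x <= 2 * f x.
Proof.
move=> hf hM t0; have [_ f0 _] := hf.
have h1 := MLR_distribution_density hf hM (lexx x) t0.
have h2 : distribution_fun f (x + t) * f x <= 1 * f x.
  by rewrite ler_wpM2r// distribution_fun_le1.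
by rewrite /gdens; lra.
Qed.

(* The likelihood ratio [gdens f 0 / gdens f t] is nondecreasing. *)
Lemma gdens_cross (R : realType) (f : R -> R) (x y t : R) :
  is_density f -> MLR f -> x <= y -> 0 <= t ->
  gdens f 0 x * gdens f t y <= gdens f 0 y * gdens f t x.
Proof.
move=> hf hM xy t0; have [_ f0 _] := hf.
rewrite /gdens !addr0.
have h1 := MLR_distribution hf hM xy t0.
have h2 := MLR_shift hM xy t0.
have Fx := distribution_fun_ge0 x hf; have Fy := distribution_fun_ge0 y hf.
(* Up to the factor 2, the claim is the sum of [h1] weighted by [f x * f y] and [h2] weighted by
   [F(x) F(y)]. *)
have := ler_wpM2l (mulr_ge0 (f0 x) (f0 y)) h1.
have := ler_wpM2l (mulr_ge0 Fx Fy) h2.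
by lra.
Qed.

(** * Signs of the derivative of the loss, and comparison off null sets *)

Lemma condC1_derive1_le0 (R : realType) (W : R -> R) (x : R) :
  condC1 W -> derivable W x 1 -> x < 0 -> derive1 W x <= 0.
Proof.
move=> [_ Wdecr _] dW x0; rewrite derive1E /derive; apply: limr_le => //.
have xN0 : 0 < - x by rewrite oppr_gt0.
near=> h.
(* Such increments keep [x + h] on the negative half-line, where [W] decreases. *)
have hx : `|h| < - x.
  near: h; apply: dnbhs0_lt; exact: xN0.
have h0 : h != 0 by near: h; exact: nbhs_dnbhs_neq.
rewrite /= scaler1.
have hlt : h < - x by rewrite (le_lt_trans (ler_norm _)).
have [hneg|hpos|hz] := ltgtP h 0; last by rewrite hz eqxx in h0.
- rewrite nmulr_rle0 ?invr_lt0// subr_ge0 ltW// Wdecr//.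
  by rewrite gtrDr.
- rewrite pmulr_rle0 ?invr_gt0// subr_le0 ltW// Wdecr//.
    by rewrite ltrDr.
  by rewrite -ltrBrDr sub0r.
Unshelve. all: by end_near. Qed.

Lemma condC1_derive1_ge0 (R : realType) (W : R -> R) (x : R) :
  condC1 W -> derivable W x 1 -> 0 < x -> 0 <= derive1 W x.
Proof.
move=> [_ _ Wincr] dW x0; rewrite derive1E /derive; apply: limr_ge => //.
near=> h.
have hx : `|h| < x.
  near: h; apply: dnbhs0_lt; exact: x0.
have h0 : h != 0 by near: h; exact: nbhs_dnbhs_neq.
rewrite /= scaler1.
have hlt : - x < h by rewrite ltrNl (le_lt_trans _ hx)// -normrN ler_norm.
have [hneg|hpos|hz] := ltgtP h 0; last by rewrite hz eqxx in h0.
- rewrite nmulr_rge0 ?invr_lt0// subr_le0 ltW// Wincr//.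
    by rewrite -ltrBlDr sub0r.
  by rewrite gtrDr.
- rewrite pmulr_rge0 ?invr_gt0// subr_ge0 ltW// Wincr//.
  by rewrite ltrDr.
Unshelve. all: by end_near. Qed.

(** Needed because (C2) controls [derive1 W] only off a null set. Both integrals are taken off a
    measurable null set containing [N]. *)
Lemma ae_le_Rintegral (d : measure_display) (T : measurableType d)
    (R : realType) (mu : {measure set T -> \bar R}) (N : set T)
    (u v : T -> R) :
  mu.-integrable [set: T] (EFin \o u) -> mu.-integrable [set: T] (EFin \o v) ->
  mu.-negligible N -> (forall x, ~ N x -> u x <= v x) ->
  \int[mu]_x u x <= \int[mu]_x v x.
Proof.
move=> iu iv [M [mM M0 NM]] uv; rewrite /Rintegral.
apply: fine_le; [exact: integrable_fin_num|exact: integrable_fin_num|].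
rewrite (negligible_integral mM _ iu)// (negligible_integral mM _ iv)//.
have mD : measurable ([set: T] `\` M) by exact: measurableD.
apply: le_integral => //; [exact: integrableS iu|exact: integrableS iv|].
move=> x /set_mem[_ Mx]; rewrite lee_fin uv// => Nx.
by apply: Mx; exact: NM.
Qed.

Lemma negligible_notin (R : realType) (N : set R) (a b : R) :
  lebesgue_measure.-negligible N -> a < b -> exists2 x, x \in `]a, b[ & ~ N x.
Proof.
move=> [M [mM M0 NM]] ab; apply: contrapT => hN.
have abM : `]a, b[%classic `<=` M.
  move=> x xab; apply: NM; apply: contrapT => Nx; apply: hN; exists x => //.
have : (lebesgue_measure `]a, b[%classic <= lebesgue_measure M)%E.
  by apply: le_measure; rewrite ?inE.
rewrite lebesgue_measure_itv/= lte_fin ab => h.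
have : (b%:E - a%:E <= 0 :> \bar R)%E by rewrite -M0.
by rewrite -EFinB lee_fin leNgt subr_gt0 ab.
Qed.

(** * From slopes to undominated shifts *)

(** Here [h] stands for the risk and [s] for minus its derivative in the shift; only these
    properties of the integrals enter. The infimum is an extended real, as it might be [-oo]. *)
Lemma undominated_shiftP (R : realType) (h s : R -> R -> R) (b : R -> R)
    (c : R) :
  (forall t x y : R, 0 <= t -> x <= y -> s t y <= s t x) ->
  (forall t : R, 0 <= t -> unique (fun x => s t x = 0) (b t)) ->
  (forall t x y : R, 0 <= t -> x < y ->
    exists2 z, z \in `]x, y[ & h t y - h t x = - s t z * (y - x)) ->
  (forall t : R, 0 <= t -> b t <= b 0) ->
  (forall r t x y : R, 0 <= r -> r <= t -> x <= y ->
    s r x - s r y <= 2 * (s t x - s t y)) ->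
  (forall x : R, exists M : R, forall t : R, 0 <= t -> s t x <= M) ->
  {within `[0, +oo[, continuous b} ->
  (~ exists2 c', (forall t, 0 <= t -> h t c' <= h t c) &
     exists2 t : R, 0 <= t & h t c' < h t c) <->
  (ereal_inf [set (b t)%:E | t in `[0%R, +oo[] <= c%:E)%E /\ c <= b 0.
Proof.
move=> s_anti s_zero h_MVT b_le s_diff s_bnd bc.
have s_gt0 (t x : R) : 0 <= t -> x < b t -> 0 < s t x.
  move=> t0 xb; have [bt0 btu] := s_zero t t0.
  rewrite lt_neqAle -[X in _ && (X <= _)]bt0 s_anti ?(ltW xb)// andbT.
  by apply/eqP => /esym /btu bE; rewrite bE ltxx in xb.
have s_lt0 (t x : R) : 0 <= t -> b t < x -> s t x < 0.
  move=> t0 xb; have [bt0 btu] := s_zero t t0.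
  rewrite lt_neqAle -[X in _ && (_ <= X)]bt0 s_anti ?(ltW xb)// andbT.
  by apply/eqP => /btu bE; rewrite bE ltxx in xb.
have h_decr (t x y : R) : 0 <= t -> x < y -> y <= b t -> h t y < h t x.
  move=> t0 xy yb; have [z] := h_MVT t x y t0 xy.
  rewrite in_itv/= => /andP[xz zy] hE.
  rewrite -subr_lt0 hE mulNr oppr_lt0 mulr_gt0 ?subr_gt0//.
  by apply: s_gt0 => //; exact: lt_le_trans yb.
have h_incr (t x y : R) : 0 <= t -> b t <= x -> x < y -> h t x < h t y.
  move=> t0 bx xy; have [z] := h_MVT t x y t0 xy.
  rewrite in_itv/= => /andP[xz zy] hE.
  rewrite -subr_gt0 hE mulr_gt0 ?subr_gt0// oppr_gt0.
  by apply: s_lt0 => //; exact: le_lt_trans xz.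
set I := ereal_inf _.
have I_le (t : R) : 0 <= t -> (I <= (b t)%:E)%E.
  by move=> t0; apply: ereal_inf_lbound; exists t => //=; rewrite in_itv/= t0.
split.
  move=> ndom; split; last first.
    rewrite leNgt; apply/negP => bc0; apply: ndom; exists (b 0) => [t t0|].
      by apply/ltW/h_incr => //; exact: b_le.
    by exists 0 => //; exact: h_incr.
  rewrite leNgt; apply/negP => cI; apply: ndom.
  have I0 := I_le 0 (lexx 0).
  (* Lying between [c] and [b 0], the infimum is real, hence a shift that can compete with [c]. *)
  have Ifin : I \is a fin_num.
    by rewrite fin_numElt (lt_trans (ltNyr c) cI) (le_lt_trans I0 (ltry _)).
  have dom (t : R) : 0 <= t -> h t (fine I) < h t c.
    move=> t0; apply: h_decr => //; first by rewrite -lte_fin fineK.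
    by rewrite -lee_fin fineK// I_le.
  exists (fine I) => [t t0|]; first by apply/ltW/dom.
  by exists 0 => //; exact: dom.
move=> [Ic c0] [c' hle [t1 t10 hlt]].
have cc' : c != c' by apply/eqP => cE; rewrite cE ltxx in hlt.
have no_att (t : R) : 0 <= t -> b t != c.
  move=> t0; apply/eqP => btc; have := hle t t0; rewrite leNgt => /negP; apply.
  have [c'c|c'c|cE] := ltgtP c' c; last by rewrite cE eqxx in cc'.
    by apply: h_decr => //; rewrite btc.
  by apply: h_incr => //; rewrite btc.
have bc_itv (t : R) : 0 <= t -> {within `[0, t], continuous b}.
  move=> t0; apply: continuous_subspaceW bc => x /=.
  by rewrite !in_itv/= => /andP[->].
(* Otherwise, since [c <= b 0], the intermediate value theorem would give a [t] with [b t = c],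
   against [no_att]. *)
have c_lt (t : R) : 0 <= t -> c < b t.
  move=> t0; rewrite ltNge; apply/negP => btc.
  have [|z] := @IVT _ b 0 t c t0 (bc_itv t t0).
    by rewrite ge_min btc orbT le_max c0.
  by rewrite in_itv/= => /andP[z0 _] /eqP; apply/negP/no_att.
have near_c e : c < e -> exists2 t : R, 0 <= t & b t < e.
  move=> ce; have : (I < e%:E)%E by rewrite (le_lt_trans Ic)// lte_fin.
  move=> /ereal_inf_lt[_ [t + <-]]; rewrite /= in_itv/= andbT => t0.
  by rewrite lte_fin; exists t.
have {cc'} cc' : c < c'.
  have [//|c'c|cE] := ltgtP c c'; last by rewrite cE eqxx in cc'.
  by have := hle 0 (lexx 0); rewrite leNgt h_decr.
have [r r0 brc'] := near_c c' cc'.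
have cbr := c_lt r r0.
pose s1 := (c + b r) / 2; pose s2 := (b r + c') / 2.
have cs1 : c < s1 by rewrite /s1; lra.
have s1b : s1 < b r by rewrite /s1; lra.
have bs2 : b r < s2 by rewrite /s2; lra.
have s2c' : s2 < c' by rewrite /s2; lra.
(* The half offsets the factor 2 of [s_diff]: the drop of [s t] from [s1] to [s2] is at least [dl]
   for all [t >= r]. *)
pose dl := (s r s1 - s r s2) / 2.
have dl0 : 0 < dl.
  by have := s_gt0 r s1 r0 s1b; have := s_lt0 r s2 r0 bs2; rewrite /dl; lra.
have [M0 M0P] := s_bnd c.
pose M := Num.max M0 1.
have M_gt0 : 0 < M by rewrite lt_max ltr01 orbT.
have MP (t : R) : 0 <= t -> s t c <= M by move=> t0; rewrite le_max M0P.
(* [near_c] does not say where its [t] lies; asking for [b t] below the minimum of [b] on [[0, r]]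
   forces [t > r]. *)
have [m] := EVT_min r0 (bc_itv r r0).
rewrite in_itv/= => /andP[m0 mr] mmin.
(* The last bound makes [M * (b t - c)], which limits the decrease of [h t] on [[c, b t]], smaller
   than [dl * (c' - s2)], its least increase on [[s2, c']]. In between [h t] increases. *)
have [t t0] : exists2 t : R, 0 <= t &
    b t < Num.min (Num.min s1 (b m)) (c + (c' - s2) * dl / M).
  apply: near_c; rewrite !lt_min cs1 c_lt//= ltrDl divr_gt0// mulr_gt0//.
  by rewrite subr_gt0.
rewrite !lt_min => /andP[/andP[bts1 btm] btc].
have rt : r <= t.
  rewrite leNgt; apply/negP => tr; move: btm; rewrite ltNge => /negP; apply.
  by apply: mmin; rewrite in_itv/= t0 ltW.
have sts2 : s t s2 <= - dl.
  have := s_diff r t s1 s2 r0 rt (ltW (lt_trans s1b bs2)).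
  by have := s_lt0 t s1 t0 bts1; rewrite /dl; lra.
have [z] := h_MVT t s2 c' t0 s2c'; rewrite in_itv/= => /andP[s2z _] hz.
have sz : s t z <= - dl.
  by apply: le_trans sts2; apply: s_anti => //; exact: ltW.
have [w] := h_MVT t c (b t) t0 (c_lt t t0); rewrite in_itv/= => /andP[cw _] hw.
have sw : s t w <= M.
  by apply: le_trans (MP t t0); apply: s_anti => //; exact: ltW.
have hbt : h t (b t) < h t s2.
  by apply: h_incr => //; exact: lt_trans (lt_trans s1b bs2).
have h1 : dl * (c' - s2) <= - s t z * (c' - s2).
  by rewrite ler_pM2r ?subr_gt0// lerNr.
have h2 : - M * (b t - c) <= - s t w * (b t - c).
  by rewrite ler_pM2r ?subr_gt0 ?c_lt// lerN2.
have h3 : M * (b t - c) < (c' - s2) * dl.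
  by rewrite mulrC -ltr_pdivlMr// ltrBlDl.
suff : h t c < h t c' by rewrite ltNge (hle t t0).
by lra.
Qed.

(** * The slope of the risk *)

Definition shift_risk (R : realType) (f W : R -> R) (t c : R) : R :=
  \int[lebesgue_measure]_x (W (x - c) * gdens f t x).

Definition slope (R : realType) (f W : R -> R) (t c : R) : R :=
  \int[lebesgue_measure]_x (derive1 W (x - c) * gdens f t x).

Lemma slope_nonincreasing (R : realType) (f W : R -> R) (t x y : R) :
  is_density f -> condC2 W -> condC3 f W -> 0 <= t -> x <= y ->
  slope f W t y <= slope f W t x.
Proof.
move=> hf [N [N0 _ W'incr]] hC3 t0 xy.
have [_ ix _] := hC3 t x t0; have [_ iy _] := hC3 t y t0.
rewrite /slope.
apply: (@ae_le_Rintegral _ _ _ lebesgue_measure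
  ([set u | N (u + - y)] `|` [set u | N (u + - x)]) _ _ iy ix).
  by apply: negligibleU; exact: negligible_shift.
move=> u /not_orP[/= Ny Nx]; rewrite ler_wpM2r ?gdens_ge0//.
by apply: W'incr => //; rewrite lerD2l lerN2.
Qed.

(** The difference integrates the almost everywhere nonnegative [W'(u - x) - W'(u - y)] against
    [gdens], so [gdens_le] applies pointwise. *)
Lemma slope_diff_le (R : realType) (f W : R -> R) (s t x y : R) :
  is_density f -> MLR f -> condC2 W -> condC3 f W ->
  0 <= s -> s <= t -> x <= y ->
  slope f W s x - slope f W s y <= 2 * (slope f W t x - slope f W t y).
Proof.
move=> hf hM [N [N0 _ W'incr]] hC3 s0 st xy.
have t0 := le_trans s0 st.
have [_ isx _] := hC3 s x s0; have [_ isy _] := hC3 s y s0.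
have [_ itx _] := hC3 t x t0; have [_ ity _] := hC3 t y t0.
have is' := integrableB measurableT isx isy.
have it' := integrableB measurableT itx ity.
rewrite /slope -!RintegralB// -RintegralZl//.
apply: (@ae_le_Rintegral _ _ _ lebesgue_measure
  ([set u | N (u + - y)] `|` [set u | N (u + - x)]) _ _ is'
  (integrableZl measurableT 2 it')).
- by apply: negligibleU; exact: negligible_shift.
move=> u /not_orP[/= Ny Nx]; rewrite -!mulrBl mulrCA.
rewrite ler_wpM2l ?gdens_le// subr_ge0.
by apply: W'incr => //; rewrite lerD2l lerN2.
Qed.

(* With [rho] the supremum of the nondecreasing ratio [gdens f 0 / gdens f t]
   left of [c], the functions [W' (x - c)] and [gdens f 0 x - rho * gdens f t x]
   both change sign from - to + at [c]. *)
Lemma slope0_ge0 (R : realType) (f W : R -> R) (t c : R) :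
  is_density f -> MLR f -> condC1 W -> condC2 W -> condC3 f W -> 0 <= t ->
  slope f W t c = 0 -> 0 <= slope f W 0 c.
Proof.
move=> hf hM hC1 [N [N0 dW _]] hC3 t0 sc0.
pose g0 := gdens f 0; pose gt := gdens f t.
have g00 x : 0 <= g0 x by exact: gdens_ge0.
have gt0 x : 0 <= gt x by exact: gdens_ge0.
have g0t x : g0 x <= 2 * gt x by exact: gdens_le.
(* Where [gt] vanishes the quotient is 0 by convention; by [g0t] the numerator vanishes there
   too. *)
pose A := [set g0 x / gt x | x in `]-oo, c[%classic].
have A2 : ubound A 2.
  move=> _ [x _ <-]; have [->|gtx] := eqVneq (gt x) 0.
    by rewrite invr0 mulr0.
  by rewrite ler_pdivrMr// lt_neqAle eq_sym gtx gt0.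
have Asup : has_sup A.
  split; last by exists 2.
  exists (g0 (c - 1) / gt (c - 1)); exists (c - 1) => //=.
  by rewrite in_itv/= gtrBl.
have rhol x : x < c -> g0 x <= sup A * gt x.
  move=> xc; have [gtx|gtx] := eqVneq (gt x) 0.
    by have := g0t x; rewrite gtx !mulr0.
  rewrite -ler_pdivrMr; last by rewrite lt_neqAle eq_sym gtx gt0.
  by apply: ub_le_sup; [exists 2|exists x => //=; rewrite in_itv].
have rhor y : c < y -> sup A * gt y <= g0 y.
  move=> cy; have [->|gty] := eqVneq (gt y) 0; first by rewrite mulr0.
  have gty0 : 0 < gt y by rewrite lt_neqAle eq_sym gty gt0.
  rewrite -ler_pdivlMr//; apply: ge_sup; first by case: Asup.
  move=> _ [x /= + <-]; rewrite in_itv/= => xc.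
  have [->|gtx] := eqVneq (gt x) 0.
    by rewrite invr0 mulr0 divr_ge0.
  rewrite ler_pdivrMr ?(lt_neqAle _ (gt x)) 1?eq_sym ?gtx ?gt0//.
  rewrite mulrAC ler_pdivlMr//.
  by apply: gdens_cross => //; exact/ltW/(lt_trans xc).
have [_ i0 _] := hC3 0 c (lexx 0); have [_ it _] := hC3 t c t0.
suff : sup A * slope f W t c <= slope f W 0 c by rewrite sc0 mulr0.
rewrite /slope -RintegralZl//.
(* The point [c] is discarded too, since the sign of [derive1 W] is known only away from 0. *)
apply: (@ae_le_Rintegral _ _ _ lebesgue_measure
  ([set u | N (u + - c)] `|` [set c])
  _ _
  (integrableZl measurableT (sup A) it) i0).
- apply: negligibleU; first exact: negligible_shift.
  exists [set c]; split => //; exact: lebesgue_measure_set1.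
move=> u /not_orP[/= Nu uc]; rewrite mulrCA.
have dWu := dW _ Nu.
have [uc'|cu|//] := ltgtP u c.
- rewrite ler_wnM2l ?rhol//.
  by apply: condC1_derive1_le0 => //; rewrite subr_lt0.
- rewrite ler_wpM2l ?rhor//.
  by apply: condC1_derive1_ge0 => //; rewrite subr_gt0.
Qed.

(** Otherwise the integrals of [f] over []-oo, n]], all zero, would converge to 1. *)
Lemma distribution_fun_gt0 (R : realType) (f : R -> R) :
  is_density f -> exists m, 0 < distribution_fun f m.
Proof.
move=> hf; have [mf f0 f1] := hf; apply: contrapT => hN.
have F0 m : distribution_fun f m = 0.
  apply/eqP; rewrite eq_le distribution_fun_ge0// andbT leNgt.
  by apply/negP => Fm; apply: hN; exists m.
pose D (n : nat) := `]-oo, n%:R]%classic : set (measurableTypeR R).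
have := @ge0_nondecreasing_set_cvg_integral _ _ R D (EFin \o f)
  lebesgue_measure.
have -> : (fun i => \int[lebesgue_measure]_(x in D i) (EFin \o f) x)%E =
    cst 0%E.
  by apply/funext => i; rewrite /D -EFin_distribution_fun// F0.
have -> : \bigcup_i D i = [set: R].
  apply/seteqP; split => // x _; exists (Num.truncn `|x|).+1 => //=.
  by rewrite /D/= in_itv/= (le_trans (ler_norm x))// ltW// truncnS_gt.
rewrite /= f1 => h.
have : (cst 0%E : nat -> \bar R) @ \oo --> (1%:E : \bar R).
  apply: h => //.
  - move=> m n mn; apply/subsetPset => x; rewrite /D/= !in_itv/=.
    by move=> /le_trans; apply; rewrite ler_nat.
  - by move=> n; exact: measurable_itv.
  - move=> n; have /measurable_EFinP mEf := mf.
    exact: (measurable_funTS mEf).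
  - by move=> n x _; rewrite lee_fin.
move/cvg_lim => /(_ (@ereal_hausdorff R)); rewrite lim_cst//.
by move=> /eqP; rewrite eqe eq_sym oner_eq0.
Qed.

(** The integrand is bounded above by an integrable function free of [t]. Left of [m],
    [W'(u - c) <= K] and [gdens f t <= 2 f]. From [m] on, [F(u) >= F(m)] gives
    [2 f(u) <= gdens f 0 u / F(m)], and (C3) at [t = 0] supplies integrability. *)
Lemma slope_bounded (R : realType) (f W : R -> R) (c : R) :
  is_density f -> MLR f -> condC2 W -> condC3 f W ->
  exists M : R, forall t : R, 0 <= t -> slope f W t c <= M.
Proof.
move=> hf hM [N [N0 dW W'incr]] hC3; have [_ f0 _] := hf.
have [m Fm] := distribution_fun_gt0 hf.
(* A reference point beyond every [u - c] with [u < m], at which the monotonicity of [W'] may be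
   used. *)
have [q] : exists2 q, q \in `]m - c, m - c + 1[ & ~ N q.
  by apply: negligible_notin => //; rewrite ltrDl.
rewrite in_itv/= => /andP[mq _] Nq.
pose K := Num.max (derive1 W q) 0.
have K0 : 0 <= K by rewrite le_max lexx orbT.
have [_ i0 _] := hC3 0 c (lexx 0).
have iv := integrableD measurableT
  (integrableZl measurableT (2 * K) (density_integrable hf))
  (integrableZl measurableT (distribution_fun f m)^-1 (integrable_abse i0)).
exists (\int[lebesgue_measure]_u (2 * K * f u +
  (distribution_fun f m)^-1 * `|derive1 W (u - c) * gdens f 0 u|)) => t t0.
have [_ it _] := hC3 t c t0.
apply: (@ae_le_Rintegral _ _ _ lebesgue_measure
  [set u | N (u + - c)] _ _ it iv).
  exact: negligible_shift.
move=> u /= Nu; set w := derive1 W (u - c).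
have gt0 : 0 <= gdens f t u by exact: gdens_ge0.
have gt2 : gdens f t u <= 2 * f u by exact: gdens_le_density.
have [um|mu] := ltP u m.
  have wK : w <= K.
    rewrite le_max; apply/orP; left; apply: W'incr => //.
    by rewrite ltW// (lt_trans _ mq)// ltrD2r.
  rewrite -[X in X <= _]addr0 lerD//; last first.
    by rewrite mulr_ge0// invr_ge0 ltW.
  rewrite (le_trans (ler_wpM2r gt0 wK))// -mulrA mulrCA.
  by rewrite ler_wpM2l.
rewrite -[X in X <= _]add0r lerD//; first by rewrite !mulr_ge0.
rewrite normrM (ger0_norm (gdens_ge0 _ _ hf)) [leRHS]mulrC ler_pdivlMr//.
rewrite -mulrA (le_trans (ler_wpM2r _ (ler_norm w)))//.
  by rewrite mulr_ge0// ltW.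
rewrite ler_wpM2l// (le_trans (ler_wpM2r (ltW Fm) gt2))//.
have := distribution_fun_nondecreasing hf mu.
by move=> /(ler_wpM2l (f0 u)); rewrite /gdens addr0; lra.
Qed.

Lemma shift_risk_MVT (R : realType) (f W : R -> R) (t x y : R) :
  condC3 f W -> 0 <= t -> x < y ->
  exists2 z, z \in `]x, y[ &
    shift_risk f W t y - shift_risk f W t x = - slope f W t z * (y - x).
Proof.
move=> hC3 t0 xy; apply: (@MVT _ _ (fun z => - slope f W t z)) => //.
  move=> z _; have [_ iz dz] := hC3 t z t0.
  suff -> : - slope f W t z =
    \int[lebesgue_measure]_u (- derive1 W (u - z) * gdens f t u) by exact: dz.
  rewrite /slope -[LHS]mulN1r -RintegralZl//.
  by apply: eq_Rintegral => u _; rewrite mulN1r mulNr.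
apply: derivable_within_continuous => z _.
by have [_ _ []] := hC3 t z t0.
Qed.

Lemma risk_shift_risk (d : measure_display) (T : measurableType d)
    (R : realType) (f W : R -> R) (P : R * R -> probability T R)
    (X1 X2 : {mfun T >-> R}) (th : R * R) (c : R) :
  is_density f -> location_model f P X1 X2 -> (forall t, 0 <= W t) ->
  condC1 W -> condC3 f W ->
  risk W P X1 X2 th (max_shift c) =
  (shift_risk f W `|th.1 - th.2| c)%:E.
Proof.
move=> hf hX W0 hC1 hC3.
rewrite (risk_max_shift th c hf hX)//; last exact: condC1_measurable.
rewrite /shift_risk /Rintegral fineK//.
have [iW _ _] := hC3 `|th.1 - th.2| c (normr_ge0 _).
exact: integrable_fin_num.
Qed.

Unset Implicit Arguments.

Theorem theorem2p3 (R : realType) (d : measure_display) (T : measurableType d)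
    (f W : R -> R) (P : R * R -> probability T R) (X1 X2 : {mfun T >-> R})
    (b : R -> R)
    (hf : is_density f)
    (hX : location_model f P X1 X2)
    (hMLR : MLR f)
    (hflim : f x @[x --> +oo] --> (0 : R))
    (hW0 : forall t : R, 0 <= W t)
    (hC1 : condC1 W)
    (hC2 : condC2 W)
    (hC3 : condC3 f W)
    (hb : forall t : R, 0 <= t ->
       unique (fun c : R =>
         (\int[lebesgue_measure]_x (derive1 W (x - c) * gdens f t x)%:E = 0)%E)
         (b t))
    (hbc : {within `[0, +oo[, continuous b}) :
  [set delta | admissible_within (risk W P X1 X2) (range (@max_shift R)) delta]
  = [set max_shift c | c in
      [set c : R | (ereal_inf [set (b t)%:E | t in `[0%R, +oo[] <= c%:E)%E
                   /\ c <= b 0]].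
Proof.
have slopeE t c : 0 <= t ->
    (\int[lebesgue_measure]_x (derive1 W (x - c) * gdens f t x)%:E =
     (slope f W t c)%:E)%E.
  move=> t0; rewrite /slope /Rintegral fineK//.
  have [_ it _] := hC3 t c t0; exact: integrable_fin_num.
have s_zero t : 0 <= t -> unique (fun c => slope f W t c = 0) (b t).
  move=> t0; have [bt0 btu] := hb t t0; split.
    by move: bt0; rewrite slopeE// => -[].
  by move=> c sc0; apply: btu; rewrite slopeE// sc0.
have s_anti t x y : 0 <= t -> x <= y -> slope f W t y <= slope f W t x.
  exact: slope_nonincreasing.
have b_le t : 0 <= t -> b t <= b 0.
  (* If [b 0 < b t], monotonicity and [slope0_ge0] would make [b t] a second zero of the slope at
     0. *)
  move=> t0; have [bt0 _] := s_zero t t0; have [b00 b0u] := s_zero 0 (lexx 0).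
  have s0 := slope0_ge0 hf hMLR hC1 hC2 hC3 t0 bt0.
  rewrite leNgt; apply/negP => b0t.
  have : slope f W 0 (b t) = 0.
    apply/eqP; rewrite eq_le s0 andbT -[X in _ <= X]b00.
    by apply: s_anti => //; exact: ltW.
  by move=> /b0u bE; rewrite bE ltxx in b0t.
have main c := @undominated_shiftP R (shift_risk f W) (slope f W) b c s_anti
  s_zero (fun t x y => shift_risk_MVT hC3) b_le
  (fun r t x y => slope_diff_le hf hMLR hC2 hC3)
  (fun x => slope_bounded x hf hMLR hC2 hC3) hbc.
have riskE th c := risk_shift_risk th c hf hX hW0 hC1 hC3.
(* The parameter [(t, 0)] realises each [t >= 0], so domination over the plane amounts to domination
   over [t >= 0]. *)
have th_of (t : R) : 0 <= t -> `|(t, 0).1 - (t, 0 : R).2| = t.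
  by move=> t0; rewrite /= subr0 ger0_norm.
pose r := risk W P X1 X2; pose h := shift_risk f W.
have dominatedP c :
    (exists delta', [/\ range (@max_shift R) delta',
        forall th, (r th delta' <= r th (max_shift c))%E
      & exists th, (r th delta' < r th (max_shift c))%E]) <->
    exists2 c', (forall t, 0 <= t -> h t c' <= h t c) &
      exists2 t, 0 <= t & h t c' < h t c.
  rewrite /r /h.
  split=> [[_ [[c' _ <-] hle [th hlt]]]|[c' hle [t t0 hlt]]].
    exists c' => [t t0|].
      by have := hle (t, 0); rewrite !riskE th_of// lee_fin.
    exists `|th.1 - th.2| => //.
    by move: hlt; rewrite !riskE lte_fin.
  exists (max_shift c'); split; first by exists c'.
    by move=> th; rewrite !riskE lee_fin hle.
  by exists (t, 0); rewrite !riskE th_of// lte_fin.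
apply/seteqP; split=> [_ [[c _ <-] /= hadm]|_ [c hc <-]].
  exists c => //; apply/main => hdom; apply: hadm; exact/dominatedP.
split; first by exists c.
by move=> /dominatedP; apply/main.
Qed.
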